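(* Let $X_0$, $Y$, $X_\varepsilon$, $S_0$, $S_\varepsilon$, $\Pi$, $\mathcal{E}$, $\mathcal{L}$, $T>0$, $W_0$, $W_\varepsilon$ and the family $(\mathbb{U}_\varepsilon)_{\varepsilon\in[0,1]}$ be as specified in the context. Suppose that the semiflow $S_0$ is Lipschitz continuous on $X_0$, uniformly in $t$ on compact intervals. Suppose the lift map $\mathcal{L}$ satisfies the following: for $T>0$ and for any bounded set $B_\varepsilon$ in $X_\varepsilon$, there exist $M=M(\|B_\varepsilon\|_{X_\varepsilon})>0$, depending on $B_\varepsilon$, and $\rho\in(0,1]$, both independent of $\varepsilon$, such that for all $t\in[0,T]$ and $(\chi,\psi)\in B_\varepsilon$, $$\|S_\varepsilon(t)(\chi,\psi)-\mathcal{L}S_0(t)\Pi(\chi,\psi)\|_{X_\varepsilon}\le M\varepsilon^\rho.$$ Then the family of sets $(\mathbb{U}_\varepsilon)_{\varepsilon\in[0,1]}$ is upper-semicontinuous in the topology of $X_\varepsilon$; precisely, $$\mathrm{dist}_{X_\varepsilon}(\mathbb{U}_\varepsilon,\mathbb{U}_0)\le M\varepsilon^\rho ,$$ where $M,\rho$ are the constants of the hypothesis for $B_\varepsilon=W_\varepsilon$.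
   Context: For subsets $A,B$ of a Banach space $X$, $\mathrm{dist}_X(A,B):=\sup_{a\in A}\inf_{b\in B}\|a-b\|_X$, and $\|B\|_X:=\sup_{b\in B}\|b\|_X$. $X_0$ and $Y$ are Banach spaces; for $\varepsilon\in(0,1]$, $X_\varepsilon=X_0\times Y$ with norm $\|(\chi,\psi)\|_{X_\varepsilon}^2=\|\chi\|_{X_0}^2+\varepsilon\|\psi\|_Y^2$. $S_0$ is a semiflow (semigroup of solution operators $S_0(t)$, $t\ge 0$) on $X_0$ and, for each $\varepsilon\in(0,1]$, $S_\varepsilon$ is a semiflow on $X_\varepsilon$. $\Pi:X_\varepsilon\to X_0$, $\Pi(\chi,\psi)=\chi$, is the projection. A map $\mathcal{E}:X_0\to Y$ which is locally Lipschitz on $X_0$ (the canonical extension) is given, and the lift map is $\mathcal{L}:X_0\to X_\varepsilon$, $\mathcal{L}\chi=(\chi,\mathcal{E}\chi)$; for a bounded set $B_0\subset X_0$, the lift of $B_0$ is $\mathcal{L}B_0=\{(\chi,\psi)\in X_\varepsilon:\chi\in B_0,\ \psi\in\mathcal{E}B_0\}$. $W_0$ is a bounded subset of $X_0$ and, for each $\varepsilon\in(0,1]$, $W_\varepsilon$ is a bounded subset of $X_\varepsilon$, with $\Pi W_\varepsilon=W_0$. (They are not assumed absorbing or positively invariant.) With $T>0$ put $\mathcal{U}_0=\bigcup_{t\in[0,T]}S_0(t)W_0$, $\mathcal{U}_\varepsilon=\bigcup_{t\in[0,T]}S_\varepsilon(t)W_\varepsilon$, and define $\mathbb{U}_\varepsilon=\mathcal{U}_\varepsilon$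 for $0<\varepsilon\le 1$ and $\mathbb{U}_0=\mathcal{L}\mathcal{U}_0$. *)

(* Defs.v *)
From HB Require Import structures.
From mathcomp Require Import all_boot all_order all_algebra.
From mathcomp Require Import all_classical all_reals all_analysis.
From mathcomp Require Import ring lra.

Set Implicit Arguments.
Unset Strict Implicit.
Unset Printing Implicit Defensive.

Import Order.TTheory GRing.Theory Num.Theory.
Import numFieldNormedType.Exports.

Local Open Scope classical_set_scope.
Local Open Scope ring_scope.

(* [wprod X0 Y e] is the space X_e: the carrier and the linear structure are
   those of X0 * Y, but the norm is sqrt (|chi|^2 + e |psi|^2), so the sup norm
   that the library puts on pairs must not be inherited. *)
Definition wprod (R : realType) (X0 Y : normedModType R) (e : {posnum R}) :
  Type := (X0 * Y)%type.

Section WeightedProduct.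
Variables (R : realType) (X0 Y : normedModType R) (e : {posnum R}).
Local Notation X := (wprod X0 Y e).

HB.instance Definition _ := GRing.Lmodule.copy X (X0 * Y)%type.

Definition wnorm (z : X) : R :=
  Num.sqrt (`|z.1| ^+ 2 + e%:num * `|z.2| ^+ 2).

Let sq_ge0 (z : X) : 0 <= `|z.1| ^+ 2 + e%:num * `|z.2| ^+ 2.
Proof. by rewrite addr_ge0 ?mulr_ge0 ?sqr_ge0. Qed.

Lemma wnorm_triangle (x y : X) : wnorm (x + y) <= wnorm x + wnorm y.
Proof.
set p := wnorm x; set q := wnorm y.
have p0 : 0 <= p by exact: sqrtr_ge0.
have q0 : 0 <= q by exact: sqrtr_ge0.
have pE : p ^+ 2 = `|x.1| ^+ 2 + e%:num * `|x.2| ^+ 2 by rewrite sqr_sqrtr.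
have qE : q ^+ 2 = `|y.1| ^+ 2 + e%:num * `|y.2| ^+ 2 by rewrite sqr_sqrtr.
have e0 : 0 < e%:num by [].
rewrite -(ger0_norm (addr_ge0 p0 q0)) -sqrtr_sqr /wnorm ler_wsqrtr//.
have h1 : `|(x + y).1| <= `|x.1| + `|y.1| by exact: ler_normD.
have h2 : `|(x + y).2| <= `|x.2| + `|y.2| by exact: ler_normD.
move: h1 h2 pE qE (normr_ge0 (x + y).1) (normr_ge0 (x + y).2).
move: (normr_ge0 x.1) (normr_ge0 x.2) (normr_ge0 y.1) (normr_ge0 y.2).
move: `|(x + y).1| `|(x + y).2| `|x.1| `|x.2| `|y.1| `|y.2| => u v a b c d.
move=> a0 b0 c0 d0 h1 h2 pE qE u0 v0.
have cs : a * c + e%:num * (b * d) <= p * q.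
  rewrite -(@ler_pXn2r _ 2)// ?nnegrE ?mulr_ge0 ?addr_ge0 ?mulr_ge0//.
  rewrite exprMn pE qE -subr_ge0.
  rewrite (_ : _ - _ = e%:num * (a * d - b * c) ^+ 2).
    by rewrite mulr_ge0// sqr_ge0.
  by ring.
have uu : u ^+ 2 <= (a + c) ^+ 2.
  by rewrite lerXn2r// nnegrE addr_ge0.
have vv : v ^+ 2 <= (b + d) ^+ 2.
  by rewrite lerXn2r// nnegrE addr_ge0.
have evv : e%:num * v ^+ 2 <= e%:num * (b + d) ^+ 2 by rewrite ler_pM2l.
rewrite sqrrD pE qE; apply: (le_trans (lerD uu evv)).
by lra.
Qed.

Lemma wnormZ (l : R) (x : X) : wnorm (l *: x) = `|l| * wnorm x.
Proof.
rewrite /wnorm /= !normrZ.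
rewrite (_ : _ + _ = `|l| ^+ 2 * (`|x.1| ^+ 2 + e%:num * `|x.2| ^+ 2)).
  by rewrite sqrtrM ?sqr_ge0// sqrtr_sqr normr_id.
by ring.
Qed.

Lemma wnorm0_eq0 (x : X) : wnorm x = 0 -> x = 0.
Proof.
case: x => x y /eqP; rewrite sqrtr_eq0 /= => h.
have a0 : 0 <= `|x| ^+ 2 by rewrite sqr_ge0.
have b0 : 0 <= `|y| ^+ 2 by rewrite sqr_ge0.
have e0 : 0 < e%:num by [].
have /eqP : `|y| ^+ 2 = 0 by nra.
have /eqP : `|x| ^+ 2 = 0 by nra.
by rewrite !expf_eq0/= !normr_eq0 => /eqP-> /eqP->.
Qed.

HB.instance Definition _ :=
  Lmodule_isNormed.Build R X wnorm_triangle wnormZ wnorm0_eq0.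

End WeightedProduct.

(* The Hausdorff semidistance, valued in the extended reals; it is -oo when
   A is empty and +oo when only B is. *)
Definition semidist (R : realType) (X : normedModType R) (A B : set X) :
    \bar R :=
  ereal_sup [set ereal_inf [set (`|a - b|)%:E | b in B] | a in A].

(* Only nonnegative times are meaningful; no continuity is included. *)
Definition semiflow (R : realType) (X : Type) (S : R -> X -> X) : Prop :=
  (forall x, S 0 x = x) /\
  (forall s t x, 0 <= s -> 0 <= t -> S (s + t) x = S s (S t x)).

Definition lipschitz_semiflow (R : realType) (X : normedModType R)
    (S : R -> X -> X) : Prop :=
  forall a b : R, 0 <= a -> exists L : R,
    forall t, a <= t <= b -> forall x y, `|S t x - S t y| <= L * `|x - y|.

Definition locally_lipschitz (R : realType) (X Y : normedModType R)
    (f : X -> Y) : Prop :=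
  forall x : X, exists2 U : set X, nbhs x U & [lipschitz f y | y in U].

Definition trajectories (R : realType) (X : Type) (S : R -> X -> X) (T : R)
    (W : set X) : set X :=
  \bigcup_(t in [set t : R | 0 <= t <= T]) (S t @` W).

Section Lift.
Variables (R : realType) (X0 Y : normedModType R).
Local Notation X := (wprod X0 Y).

Definition proj_X0 (e : {posnum R}) (z : X e) : X0 := z.1.

Definition lift_map (Ext : X0 -> Y) (e : {posnum R}) (chi : X0) : X e :=
  (chi, Ext chi).

(* The lift of a set is the full product of B0 and its image under Ext, not
   the graph of Ext over B0. *)
Definition lift_set (Ext : X0 -> Y) (e : {posnum R}) (B0 : set X0) :
    set (X e) :=
  [set z | B0 z.1 /\ (Ext @` B0) z.2].

Variables (S0 : R -> X0 -> X0) (S : forall e : {posnum R}, R -> X e -> X e)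
  (Ext : X0 -> Y).

Definition bounded_family (B : forall e : {posnum R}, set (X e)) : Prop :=
  forall e : {posnum R}, e%:num <= 1 -> bounded_set (B e).

(* M and rho are chosen for the whole family (B e), hence do not depend
   on e. *)
Definition lift_constants (T : R) (B : forall e : {posnum R}, set (X e))
    (M rho : R) : Prop :=
  [/\ 0 < M, 0 < rho <= 1 &
    forall e : {posnum R}, e%:num <= 1 ->
    forall t, 0 <= t <= T -> forall z, B e z ->
      `|S t z - lift_map Ext e (S0 t (proj_X0 z))| <= M * e%:num `^ rho].

(* Demanded of every family of bounded sets, even one whose radii blow up as
   e -> 0. At t = 0 the left-hand side above is sqrt e * |psi - Ext chi|, so
   this can only hold when Y = 0; it is therefore worth knowing which results
   need lift_constants for a single family only. *)
Definition lift_hypothesis : Prop :=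
  forall T : R, 0 < T ->
  forall B : forall e : {posnum R}, set (X e), bounded_family B ->
  exists M rho, lift_constants T B M rho.

(* The sets UU0 e are the incarnations in X_e of the member of index 0 of the
   family. *)
Definition upper_semicontinuous_at0
    (UU UU0 : forall e : {posnum R}, set (X e)) : Prop :=
  forall delta : R, 0 < delta -> exists2 eta : R, 0 < eta &
    forall e : {posnum R}, e%:num <= 1 -> e%:num < eta ->
      (semidist (UU e) (UU0 e) <= delta%:E)%E.

End Lift.

Arguments lift_set {R X0 Y} Ext e B0.

(* Main.v *)
Require Import Defs.
From HB Require Import structures.
From mathcomp Require Import all_boot all_order all_algebra.
From mathcomp Require Import all_classical all_reals all_analysis.

(** Why the estimate holds: a point of the perturbed family is [S e t z] with
    [z] in [W e] and [t] in [[0, T]].  Flowing the projection of [z] by the limit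
    semiflow for the same time and lifting the result gives a point of the
    comparison set, because the projection of [W e] is [W0]; and the hypothesis
    on the lift says exactly that this point is within [M * e `^ rho] of
    [S e t z].  Since the semidistance only asks for one nearby comparison point
    for each point ([semidist_le]), this bound passes to the semidistance
    ([semidist_trajectories_le]).  The bound is a positive power of [e], so
    it vanishes with [e], which is upper semicontinuity
    ([power_rate_upper_semicontinuous]). *)

Set Implicit Arguments.
Unset Strict Implicit.
Unset Printing Implicit Defensive.

Import Order.TTheory GRing.Theory Num.Theory.
Import numFieldNormedType.Exports.

Local Open Scope classical_set_scope.
Local Open Scope ring_scope.

Lemma semidist_le (R : realType) (X : normedModType R) (A B : set X) (r : R) :
  (forall a, A a -> exists2 b, B b & `|a - b| <= r) ->
  (semidist A B <= r%:E)%E.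
Proof.
move=> near_B; apply: ge_ereal_sup => _ [a Aa <-].
have [b Bb ab_r] := near_B a Aa.
apply: (@le_trans _ _ (`|a - b|)%:E); last by rewrite lee_fin.
by apply: ereal_inf_lbound; exists b.
Qed.

(** The threshold solves [M * eta `^ rho = delta]. *)
Lemma power_rate_upper_semicontinuous (R : realType) (X0 Y : normedModType R)
    (A B : forall e : {posnum R}, set (wprod X0 Y e)) (M rho : R) :
  0 < M -> 0 < rho ->
  (forall e : {posnum R}, e%:num <= 1 ->
    (semidist (A e) (B e) <= (M * e%:num `^ rho)%:E)%E) ->
  upper_semicontinuous_at0 A B.
Proof.
move=> M_gt0 rho_gt0 rateAB delta delta_gt0.
have dM_gt0 : 0 < delta / M by rewrite divr_gt0.
exists ((delta / M) `^ rho^-1); first by rewrite powR_gt0.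
move=> e e_le1 e_lt; apply: le_trans (rateAB e e_le1) _.
rewrite lee_fin mulrC -ler_pdivlMr//.
have -> : delta / M = ((delta / M) `^ rho^-1) `^ rho.
  by rewrite -powRrM mulVf ?gt_eqF// powRr1// ltW.
by apply: ge0_ler_powR; rewrite ?nnegrE ?powR_ge0// ltW.
Qed.

(** The inclusion of the projection of [W] in [W0] puts the lifted limit
    trajectory through the projected initial point in the comparison set; the
    same time [t] serves for both flows. *)
Lemma semidist_trajectories_le (R : realType) (X0 Y : normedModType R)
    (e : {posnum R}) (S0 : R -> X0 -> X0)
    (Se : R -> wprod X0 Y e -> wprod X0 Y e) (Ext : X0 -> Y) (T r : R)
    (W0 : set X0) (W : set (wprod X0 Y e)) :
  (@proj_X0 R X0 Y e) @` W `<=` W0 ->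
  (forall t, 0 <= t <= T -> forall z, W z ->
    `|Se t z - lift_map Ext e (S0 t (proj_X0 z))| <= r) ->
  (semidist (trajectories Se T W)
            (lift_set Ext e (trajectories S0 T W0)) <= r%:E)%E.
Proof.
move=> projW close; apply: semidist_le => _ [t tT [z Wz <-]].
have limit_point : trajectories S0 T W0 (S0 t (proj_X0 z)).
  exists t; first exact: tT.
  by exists (proj_X0 z) => //; apply: projW; exists z.
exists (lift_map Ext e (S0 t (proj_X0 z))); last exact: close.
by split=> //; exists (S0 t (proj_X0 z)).
Qed.

Theorem theorem4p4 (R : realType) (X0 Y : completeNormedModType R)
    (S0 : R -> X0 -> X0)
    (S : forall e : {posnum R}, R -> wprod X0 Y e -> wprod X0 Y e)
    (Ext : X0 -> Y) (T : R)
    (W0 : set X0) (W : forall e : {posnum R}, set (wprod X0 Y e))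
    (hS0 : semiflow S0)
    (hS : forall e : {posnum R}, e%:num <= 1 -> semiflow (S e))
    (hExt : locally_lipschitz Ext)
    (hT : 0 < T)
    (hW0 : bounded_set W0)
    (hW : bounded_family W)
    (hPiW : forall e : {posnum R}, e%:num <= 1 -> (@proj_X0 R X0 Y e) @` W e = W0)
    (hS0lip : lipschitz_semiflow S0) :
  let UU e := trajectories (S e) T (W e) in
  let UU0 e := lift_set Ext e (trajectories S0 T W0) in
  let rate M rho := forall e : {posnum R}, e%:num <= 1 ->
    (semidist (UU e) (UU0 e) <= (M * e%:num `^ rho)%:E)%E in
  (lift_hypothesis S0 S Ext ->
    upper_semicontinuous_at0 UU UU0 /\
    exists M rho, lift_constants S0 S Ext T W M rho /\ rate M rho) /\
  (forall M rho, lift_constants S0 S Ext T W M rho ->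
    upper_semicontinuous_at0 UU UU0 /\ rate M rho).
Proof.
move=> UU UU0 rate.
have from_constants M rho : lift_constants S0 S Ext T W M rho ->
    upper_semicontinuous_at0 UU UU0 /\ rate M rho.
  move=> [M_gt0 /andP[rho_gt0 _] close].
  have rateM : rate M rho.
    move=> e e_le1; apply: semidist_trajectories_le; last exact: close.
    by rewrite hPiW.
  by split=> //; exact: power_rate_upper_semicontinuous M_gt0 rho_gt0 rateM.
split=> // lift_hyp.
have [M [rho constM]] := lift_hyp T hT W hW.
have [usc rateM] := from_constants M rho constM.
by split=> //; exists M, rho.
Qed.
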